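(* For every integer $n>9$, the inequality $\xi(n)<\left(2^{2^{n-5}}-1\right)^{2^{n-5}}+1$ implies that $2^{2^{n-5}}+1$ is composite.
   Context: For a positive integer $n$, let $B_n=\{x_i \cdot x_j=x_k,\ x_i+1=x_k : i,j,k \in \{1,\ldots,n\}\}$, a finite set of equations in the variables $x_1,\ldots,x_n$ (the indices need not be distinct). For a positive integer $n$, $\xi(n)$ denotes the smallest positive integer $b$ such that for each system $\mathcal{S} \subseteq B_n$ with a unique solution in positive integers $x_1,\ldots,x_n$, this solution belongs to $[1,b]^n$. *)

(* Defs.v *)
From HB Require Import structures.
From mathcomp Require Import all_boot.
From mathcomp Require Import boolp.

Set Implicit Arguments.
Unset Strict Implicit.
Unset Printing Implicit Defensive.

(* The elements of B_n, as formal equations: [EqMul i j k] stands for         *)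
(* x_i * x_j = x_k and [EqSucc i k] for x_i + 1 = x_k. The variables are      *)
(* indexed by {0, ..., n-1} instead of {1, ..., n}.                           *)
Inductive equation (n : nat) : Type :=
  | EqMul of 'I_n & 'I_n & 'I_n
  | EqSucc of 'I_n & 'I_n.

Arguments EqMul {n} i j k.
Arguments EqSucc {n} i k.

Definition equation_code n (e : equation n) :
    ('I_n * 'I_n * 'I_n + 'I_n * 'I_n)%type :=
  match e with
  | EqMul i j k => inl (i, j, k)
  | EqSucc i k => inr (i, k)
  end.

Definition equation_decode n
    (c : ('I_n * 'I_n * 'I_n + 'I_n * 'I_n)%type) : equation n :=
  match c with
  | inl (i, j, k) => EqMul i j k
  | inr (i, k) => EqSucc i k
  end.

Lemma equation_codeK n : cancel (@equation_code n) (@equation_decode n).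
Proof. by case. Qed.

HB.instance Definition _ n :=
  Finite.copy (equation n) (can_type (@equation_codeK n)).

Definition satisfies n (x : {ffun 'I_n -> nat}) (e : equation n) : Prop :=
  match e with
  | EqMul i j k => x i * x j = x k
  | EqSucc i k => x i + 1 = x k
  end.

Definition positive_solution n (S : {set equation n})
    (x : {ffun 'I_n -> nat}) : Prop :=
  (forall i, 0 < x i) /\ (forall e, e \in S -> satisfies x e).

Definition unique_positive_solution n (S : {set equation n})
    (x : {ffun 'I_n -> nat}) : Prop :=
  positive_solution S x /\ (forall y, positive_solution S y -> y = x).

Definition bounds_unique_solutions (n b : nat) : Prop :=
  forall (S : {set equation n}) (x : {ffun 'I_n -> nat}),
    unique_positive_solution S x -> forall i, 1 <= x i <= b.

Lemma bounds_unique_solutions_ex n :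
  exists b, (0 < b) && `[< bounds_unique_solutions n b >].
Proof.
have /choice[f fP] (S : {set equation n}) : exists b,
    forall x, unique_positive_solution S x -> forall i, 1 <= x i <= b.
  have [[x [[x0 xS] xU]]|noS] := pselect (exists x, unique_positive_solution S x).
    exists (\max_i x i) => y [ySol _] i.
    by rewrite (xU _ ySol) x0 leq_bigmax.
  by exists 0 => x Sx; case: noS; exists x.
exists (\max_S f S).+1; apply/asboolP => S x Sx i.
have /andP[-> xi] := fP S x Sx i.
exact: leq_trans xi (leqW (leq_bigmax S)).
Qed.

Definition xi (n : nat) : nat := ex_minn (bounds_unique_solutions_ex n).

Definition composite (m : nat) : bool := (1 < m) && ~~ prime m.

(* Main.v *)
Require Import Defs.
From mathcomp Require Import all_boot.
From mathcomp Require Import boolp zify.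

(** Put [k = n - 5] and suppose that the Fermat number [F = 2 ^ 2 ^ k + 1] is
    prime.  Since [a] is congruent to [-2] modulo [a + 2] and [2 ^ k] is even,
    [a + 2] divides [a ^ 2 ^ k + 1] exactly when it divides [F]; as [F] is
    prime and [a + 2 > 1], this forces [a + 2 = F] ([fermat_dvd]).  Hence the
    equation [(a + 2) * q = a ^ 2 ^ k + 1] has exactly one solution in positive
    integers, and there [a = 2 ^ 2 ^ k - 1].

    This equation can be spelled out with the [k + 5] unknowns
      [a, a ^ 2, a ^ 4, ..., a ^ 2 ^ k, a ^ 2 ^ k + 1, a + 1, a + 2, q],
    the powers coming from [k] successive squarings ([fermat_chainP]).  The
    resulting system in [n] variables has a unique positive solution, one of
    whose entries is [(2 ^ 2 ^ k - 1) ^ 2 ^ k + 1], so [xi n] is at least this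
    number ([fermat_prime_xi]); the hypothesis on [xi n] thus rules out the
    primality of [F]. *)

(** The system used is the largest one that [x] solves: it makes [x] a solution
    for free, and adding equations can only help uniqueness. *)
Lemma leq_xi n (x : {ffun 'I_n -> nat}) :
    (forall i, 0 < x i) ->
    (forall y : {ffun 'I_n -> nat}, (forall i, 0 < y i) ->
       (forall e, satisfies x e -> satisfies y e) -> y = x) ->
  forall i, x i <= xi n.
Proof.
move=> x_gt0 x_uniq i; rewrite /xi; case: ex_minnP => b.
case/andP=> _ /asboolP b_bound _.
suff /b_bound/(_ i)/andP[]: unique_positive_solution
  [set e | `[< satisfies x e >]] x by [].
split=> [|y [y_gt0 yS]]; first by split=> // e; rewrite inE => /asboolP.
by apply: x_uniq => // e xe; apply: yS; rewrite inE; apply/asboolP.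
Qed.

(** Modulo [a + 2] the number [a] is [-2], and the sign disappears because the
    exponent is even. *)
Lemma exp_double_mod_add2 a m : a ^ m.*2 = 2 ^ m.*2 %[mod a + 2].
Proof.
rewrite -mul2n !expnM -[LHS]modnXm -[RHS]modnXm.
suff -> : a ^ 2 = 2 ^ 2 %[mod a + 2] by [].
rewrite -(modnMDl 2 (a ^ 2)) -(modnMDl a (2 ^ 2)); congr (_ %% _); lia.
Qed.

Lemma fermat_dvd k a : 0 < k -> prime (2 ^ 2 ^ k + 1) ->
  (a + 2 %| a ^ 2 ^ k + 1) = (a == 2 ^ 2 ^ k - 1).
Proof.
case: k => // k _ F_prime.
have -> : (a + 2 %| a ^ 2 ^ k.+1 + 1) = (a + 2 %| 2 ^ 2 ^ k.+1 + 1).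
  by rewrite /dvdn expnS mul2n -modnDml exp_double_mod_add2 modnDml.
have /primeP[_ F_dvd] := F_prime.
move: F_dvd (expn_gt0 2 (2 ^ k.+1)); set P := 2 ^ _ => F_dvd /= P_gt0.
apply/idP/eqP => [/F_dvd/orP[]/eqP|->]; [lia|lia|].
by have -> : P - 1 + 2 = P + 1 by lia.
Qed.

(** The two parameters are themselves unknowns: [a] is the entry of index [0]
    and [q] the last one, of index [k + 4]. *)
Definition fermat_chain k a q j : nat :=
  if j <= k then a ^ 2 ^ j
  else nth 0 [:: a ^ 2 ^ k + 1; a + 1; a + 2; q] (j - k.+1).

Definition fermat_system k (y : nat -> nat) : Prop :=
  [/\ forall j, j < k -> y j * y j = y j.+1,
      y k + 1 = y k.+1, y 0 + 1 = y k.+2, y k.+2 + 1 = y k.+3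
    & y k.+3 * y k.+4 = y k.+1].

Lemma fermat_chain_low k a q j : j <= k -> fermat_chain k a q j = a ^ 2 ^ j.
Proof. by rewrite /fermat_chain => ->. Qed.

Lemma fermat_chain_high k a q j :
  fermat_chain k a q (j + k.+1)
    = nth 0 [:: a ^ 2 ^ k + 1; a + 1; a + 2; q] j.
Proof. by rewrite /fermat_chain addnK ifF //; lia. Qed.

Lemma fermat_chain_gt0 k a q j :
  0 < a -> 0 < q -> j < k + 5 -> 0 < fermat_chain k a q j.
Proof.
move=> a_gt0 q_gt0 lt_j; have [le_jk|lt_kj] := leqP j k.
  by rewrite fermat_chain_low // expn_gt0 a_gt0.
rewrite -(subnK lt_kj) fermat_chain_high.
have: j - k.+1 < 4 by lia.
by case: (j - k.+1) => [|[|[|[|]]]] //=; lia.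
Qed.

Lemma fermat_chain_system k a q :
  (a + 2) * q = a ^ 2 ^ k + 1 -> fermat_system k (fermat_chain k a q).
Proof.
move=> aq; have high := fermat_chain_high k a q; split.
- move=> j lt_jk; rewrite !fermat_chain_low //; last exact: ltnW.
  by rewrite mulnn -expnM expnS mulnC.
- by rewrite fermat_chain_low // (high 0).
- by rewrite fermat_chain_low // (high 1).
- by rewrite (high 1) (high 2) /=; lia.
- by rewrite (high 2) (high 3) (high 0).
Qed.

(** Read in order of the indices, each equation but the product determines a new
    entry from earlier ones, so a solution is determined by its first and last
    entries; the product is then the only constraint left on these two. *)
Lemma fermat_chainP k y : fermat_system k y ->
  (y 0 + 2) * y k.+4 = y 0 ^ 2 ^ k + 1 /\
  forall j, j < k + 5 -> y j = fermat_chain k (y 0) (y k.+4) j.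
Proof.
case=> sqr yk1 yk2 yk3 yk4.
have low j : j <= k -> y j = y 0 ^ 2 ^ j.
  elim: j => [|j IHj] lt_jk; first by rewrite expn1.
  by rewrite -sqr // IHj 1?ltnW // mulnn -expnM expnS mulnC.
have yk := low k (leqnn k); split; first by rewrite -yk yk1 -yk4 -yk3 -yk2; lia.
move=> j lt_j; have [le_jk|lt_kj] := leqP j k.
  by rewrite fermat_chain_low // low.
rewrite -(subnK lt_kj) fermat_chain_high.
have: j - k.+1 < 4 by lia.
by case: (j - k.+1) => [|[|[|[|]]]] //= _; rewrite ?addSn add0n -?yk //; lia.
Qed.

Lemma fermat_prime_xi k : 0 < k -> prime (2 ^ 2 ^ k + 1) ->
  (2 ^ 2 ^ k - 1) ^ 2 ^ k + 1 <= xi (k + 5).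
Proof.
move=> k_gt0 F_prime; set a := 2 ^ 2 ^ k - 1.
have a_gt0 : 0 < a by rewrite subn_gt0 -[1](expn0 2) ltn_exp2l // expn_gt0.
have /dvdnP[q] : a + 2 %| a ^ 2 ^ k + 1 by rewrite fermat_dvd.
rewrite mulnC => /esym aq.
have q_gt0 : 0 < q by case: (q) aq => //; lia.
(* [inord] lands in ordinals below an explicit successor. *)
rewrite [k + 5]addnS.
have lt_ord (i : 'I_(k + 4).+1) : i < k + 5 by have := ltn_ord i; lia.
pose x : {ffun 'I_(k + 4).+1 -> nat} := [ffun i : 'I__ => fermat_chain k a q i].
have xE j : j < k + 5 -> x (inord j) = fermat_chain k a q j.
  by move=> lt_j; rewrite ffunE inordK // -addnS.
have -> : a ^ 2 ^ k + 1 = x (inord k.+1).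
  by rewrite xE ?(fermat_chain_high k a q 0) //; lia.
apply: leq_xi => [i|y y_gt0 xy].
  by rewrite ffunE fermat_chain_gt0 // lt_ord.
pose y' j := y (inord j).
have mulP i j l : i < k + 5 -> j < k + 5 -> l < k + 5 ->
    fermat_chain k a q i * fermat_chain k a q j = fermat_chain k a q l ->
  y' i * y' j = y' l.
  move=> lt_i lt_j lt_l.
  by have := xy (EqMul (inord i) (inord j) (inord l)); rewrite /= !xE.
have succP i j : i < k + 5 -> j < k + 5 ->
    fermat_chain k a q i + 1 = fermat_chain k a q j -> y' i + 1 = y' j.
  move=> lt_i lt_j.
  by have := xy (EqSucc (inord i) (inord j)); rewrite /= !xE.
(* Since [y] satisfies all equations that [x] does, it inherits the system. *)
have [aq' y'E] : (y' 0 + 2) * y' k.+4 = y' 0 ^ 2 ^ k + 1 /\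
    forall j, j < k + 5 -> y' j = fermat_chain k (y' 0) (y' k.+4) j.
  apply: fermat_chainP; have [sqr k1 k2 k3 k4] := fermat_chain_system _ _ _ aq.
  split=> [j lt_jk||||]; [apply: mulP|apply: succP|apply: succP|apply: succP
    |apply: mulP]; by [lia|auto].
have y'0 : y' 0 = a.
  by apply/eqP; rewrite -fermat_dvd // -aq' dvdn_mulr.
have y'q : y' k.+4 = q.
  have /eqP : (a + 2) * y' k.+4 = (a + 2) * q by rewrite aq -y'0.
  by rewrite eqn_pmul2l ?addn2 // => /eqP.
apply/ffunP => i; have lt_i := lt_ord i.
by rewrite ffunE -[LHS]/(y i) -{1}(inord_val i) [LHS]y'E // y'0 y'q.
Qed.

Theorem corollary5 (n : nat) (hn : 9 < n)
  (hxi : xi n < (2 ^ (2 ^ (n - 5)) - 1) ^ (2 ^ (n - 5)) + 1) :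
  composite (2 ^ (2 ^ (n - 5)) + 1).
Proof.
have F_gt1 : 1 < 2 ^ 2 ^ (n - 5) + 1 by rewrite addn1 ltnS expn_gt0.
rewrite /composite F_gt1 /=; apply: contraL hxi => F_prime; rewrite -leqNgt.
have n5 : n - 5 + 5 = n by apply: subnK; lia.
by rewrite -{3}n5; apply: fermat_prime_xi => //; lia.
Qed.
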